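(* Suppose that $\Omega=\{\bm x\in\mathbb R^n:\bm A\bm x\le\bm b\}$ is compact and that $f:\mathbb R^n\to\mathbb R$ and $\bm h:\mathbb R^n\to\mathbb R^{\ell}$ are continuously differentiable on $\Omega$. Suppose that the algorithm NPASA (defined in the context), applied with $\varepsilon=0$ to the problem of minimizing $f(\bm x)$ subject to $\bm h(\bm x)=\bm 0$, $\bm A\bm x\le \bm b$, generates an infinite sequence $\{(\bm x_k,\bm\lambda_k,\bm\mu_k)\}_{k=0}^\infty$ with $\bm x_k\in\Omega$. For $j\in\{1,2\}$ let $\mathcal S_j$ be the set of indices $k$ such that $\bm x_k$ is generated in phase $j$ of NPASA. Suppose that: (i) for every $k\in\mathcal S_1$, with $\bm\nu_{k-1}=Proj_{[-\bar\lambda,\bar\lambda]}(\bm\lambda_{k-1})$, the conditions (G1) and (G2) defined in the context hold at $(\bm u,\bm\nu,q)=(\bm x_{k-1},\bm\nu_{k-1},q_k)$, where $q_k$ is the value of the penalty parameter with which $\bm x_k$ was generated; (ii) if $\bm x^*$ is a subsequential limit point of $\{\bm x_k\}_{k=0}^\infty$, then the matrix $\begin{bmatrix}\nabla\bm h(\bm x^* )\\ \bm A_{\mathcal A(\bm x^* )}\end{bmatrix}$ has full row rank. Then $$\liminf_{k\to\infty}E_1(\bm x_k,\bm\lambda_k,\bm\mu_k)=0 .$$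
   Context: **Problem and notation.** $f:\mathbb R^n\to\mathbb R$ and $\bm h:\mathbb R^n\to\mathbb R^\ell$ are continuously differentiable, $\bm A\in\mathbb R^{m\times n}$, $\bm b\in\mathbb R^m$, $\bm r(\bm x)=\bm A\bm x-\bm b$, $\Omega=\{\bm x:\bm r(\bm x)\le\bm 0\}$. Gradients are row vectors; $\nabla\bm h\in\mathbb R^{\ell\times n}$ is the Jacobian; $\|\cdot\|$ is the Euclidean norm. $\mathcal A(\bm x)=\{i: r_i(\bm x)=0\}$ is the active set and $\bm A_{\mathcal A(\bm x)}$ is the submatrix of $\bm A$ with rows indexed by $\mathcal A(\bm x)$. $Proj_{[a,b]}(\bm v)$ is the componentwise projection of $\bm v$ onto $[a,b]$. $\mathcal L(\bm x,\bm\lambda,\bm\mu)=f(\bm x)+\bm\lambda^{\intercal}\bm h(\bm x)+\bm\mu^{\intercal}\bm r(\bm x)$ and $\mathcal L_q(\bm x,\bm\lambda)=f(\bm x)+\bm\lambda^{\intercal}\bm h(\bm x)+q\|\bm h(\bm x)\|^2$. With $\bm\Phi$ the componentwise minimum, $\Phi_i(\bm s,\bm t)=\min\{s_i,t_i\}$, the error estimators are - $E_{m,0}(\bm x,\bm\lambda,\bm\mu)=\|\nabla_x\mathcal L(\bm x,\bm\lambda,\bm\mu)\|^2-\bm\mu^{\intercal}\bm r(\bm x)$, - $E_{m,1}(\bm x,\bm\lambda,\bm\mu)=\|\nabla_x\mathcal L(\bm x,\bm\lambda,\bm\mu)\|^2+\|\bm\Phi(-\bm r(\bm x),\bm\mu)\|^2$,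 - $E_c(\bm x)=\|\bm h(\bm x)\|^2$, - $E_1(\bm x,\bm\lambda,\bm\mu)=\sqrt{E_{m,1}(\bm x,\bm\lambda,\bm\mu)+E_c(\bm x)}$. For given $\bm\nu\in\mathbb R^\ell$ and $q\in\mathbb R$ write $\bm g(\bm x)=\nabla_x\mathcal L_q(\bm x,\bm\nu)^{\intercal}$. For $\alpha>0$ let $\bm y(\bm x,\alpha)$ be the minimizer of $\frac12\|\bm x-\alpha\bm g(\bm x)-\bm y\|^2$ over $\bm y\in\Omega$, and let $\bm\mu(\bm x,\alpha)\ge\bm 0$ be a KKT multiplier vector for this projection problem: $\bm y(\bm x,\alpha)-\bm x+\alpha\bm g(\bm x)+\bm A^{\intercal}\bm\mu(\bm x,\alpha)=\bm 0$ and $\mu_i(\bm x,\alpha)\,r_i(\bm y(\bm x,\alpha))=0$ for all $i$. **Algorithm GS (global step).** Input $(\bm x,\bm\lambda,\bm\mu)$, $\bar\lambda>0$, $q$. Set $\bar{\bm\lambda}=Proj_{[-\bar\lambda,\bar\lambda]}(\bm\lambda)$; $\bm x'\in\arg\min\{\mathcal L_q(\bm x,\bar{\bm\lambda}):\bm x\in\Omega\}$ (computed by the modified PASA algorithm below, started at the input $\bm x$); $\bm\lambda'=\bar{\bm\lambda}+2q\bm h(\bm x')$; $\bm\mu'=\bm\mu(\bm x',1)$ taken with $\bm\nu=\bar{\bm\lambda}$ and this $q$, that is, with $\bm g(\bm x')=\nabla_x\mathcal L_q(\bm x',\bar{\bm\lambda})^{\intercal}$ and $\bm y'$ the minimizer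 of $\frac12\|\bm x'-\bm g(\bm x')-\bm y\|^2$ over $\bm y\in\Omega$, $\bm\mu'\ge\bm 0$ is a KKT multiplier vector for this projection problem: $\bm y'-\bm x'+\bm g(\bm x')+\bm A^{\intercal}\bm\mu'=\bm 0$ and $\mu'_i\,r_i(\bm y')=0$ for all $i$. Return $(\bm x',\bm\lambda',\bm\mu')$. **Algorithm LS (local step).** Input $(\bm x,\bm\lambda,\bm\mu)$ and the parameters $\theta,\alpha,\beta,\sigma,\tau,p,\gamma,\delta$ below. *Constraint step.* Set $\bm w_0=\bm x$, $i=0$. While $E_c(\bm w_i)>\theta E_{m,1}(\bm x,\bm\lambda,\bm\mu)$: choose $p_i\ge\max\{\beta^2,\|\bm h(\bm w_i)\|^{-2}\}$, set $s_i=1$, let $[\overline{\bm w}_{i+1},\bm y_{i+1}]=\arg\min\{\|\bm w-\bm w_i\|^2+p_i\|\bm y\|^2:\nabla\bm h(\bm w_i)(\bm w-\bm w_i)+\bm y=-\bm h(\bm w_i),\ \bm w\in\Omega\}$ and $\alpha_{i+1}=1-\|\bm y_{i+1}\|$. If $\alpha_{i+1}<\alpha$, return $(\bm x,\bm\lambda,\bm\mu)$ and exit LS. Otherwise, while $\|\bm h(\bm w_i+s_i(\overline{\bm w}_{i+1}-\bm w_i))\|>(1-\tau\alpha_{i+1}s_i)\|\bm h(\bm w_i)\|$ replace $s_i$ by $\sigma s_i$; then set $\bm w_{i+1}=\bm w_i+s_i(\overline{\bm w}_{i+1}-\bm w_i)$ and $i\leftarrow i+1$. On exit from the loop set $\bm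 w=\bm w_i$. *Multiplier step.* Set $\bm z_0=\bm w$, $p_0=p$, $i=0$; choose $(\bm\nu_0,\bm\eta_0)\in\arg\min\{E_{m,0}(\bm z_0,\bm\nu,\bm\eta)+\gamma\|[\bm\nu,\bm\eta]\|^2:\bm\eta\ge\bm 0\}$ and $\bm\eta_0'\in\arg\min\{E_{m,1}(\bm z_0,\bm\nu_0,\bm\eta):\bm\eta\ge\bm 0\}$. While $E_{m,1}(\bm z_i,\bm\nu_i,\bm\eta_i')>\theta E_c(\bm w)$: increase the penalty $p_i$ if necessary; let $\bm z_{i+1}=\arg\min\{f(\bm z)+\bm\nu_i^{\intercal}\bm h(\bm z)+p_i\|\bm h(\bm z)-\bm h(\bm z_i)\|^2:\nabla\bm h(\bm z_i)(\bm z-\bm z_i)=\bm 0,\ \bm z\in\Omega\}$; choose $(\bm\nu_{i+1},\bm\eta_{i+1})\in\arg\min\{E_{m,0}(\bm z_{i+1},\bm\nu,\bm\eta)+\gamma\|[\bm\nu,\bm\eta]\|^2:\bm\eta\ge\bm 0\}$ and $\bm\eta'_{i+1}\in\arg\min\{E_{m,1}(\bm z_{i+1},\bm\nu_{i+1},\bm\eta):\bm\eta\ge\bm 0\}$. If $E_{m,1}(\bm z_{i+1},\bm\nu_{i+1},\bm\eta_{i+1}')>\delta E_{m,1}(\bm z_i,\bm\nu_i,\bm\eta_i')$, return $(\bm x,\bm\lambda,\bm\mu)$ and exit LS; otherwise $i\leftarrow i+1$. On exit from the loop return $(\bm z_i,\bm\nu_i,\bm\eta_i')$. **Algorithm NPASA.**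 Inputs: initial guess $(\bm x_0,\bm\lambda_0,\bm\mu_0)$, $\varepsilon\ge0$, $\theta\in(0,1)$, $\phi>1$, $\bar\lambda>0$, $q_0\ge1$, $\alpha\in(0,1]$, $\beta\ge1$, $\sigma\in(0,1)$, $\tau\in(0,1)$, $p>1$ (large), $\delta\in(0,1)$, $\gamma>0$. Set $e_0=E_1(\bm x_0,\bm\lambda_0,\bm\mu_0)$, $k=0$, and go to phase one. *Phase one.* On entering, set $q_k\leftarrow\max\{\phi,(e_{k-1})^{-1}\}\,q_{k-1}$ (for the very first entry, $k=0$, the input value $q_0$ is used). While $E_1(\bm x_k,\bm\lambda_k,\bm\mu_k)>\varepsilon$: set $(\bm x_{k+1},\bm\lambda_{k+1},\bm\mu_{k+1})\leftarrow GS(\bm x_k,\bm\lambda_k,\bm\mu_k;\bar\lambda,q_k)$, $q_{k+1}\leftarrow q_k$, $e_{k+1}\leftarrow\min\{E_1(\bm x_{k+1},\bm\lambda_{k+1},\bm\mu_{k+1}),e_k\}$, $k\leftarrow k+1$; then, if $E_{m,1}(\bm x_k,\bm\lambda_k,\bm\mu_k)\le\theta E_c(\bm x_k)$, go to phase two. *Phase two.* While $E_1(\bm x_k,\bm\lambda_k,\bm\mu_k)>\varepsilon$: set $(\bm z,\bm\nu,\bm\eta)\leftarrow LS(\bm x_k,\bm\lambda_k,\bm\mu_k)$. If $E_1(\bm z,\bm\nu,\bm\eta)>\theta E_1(\bm x_k,\bm\lambda_k,\bm\mu_k)$, go to phase one (with the same $k$); otherwise set $(\bm x_{k+1},\bm\lambda_{k+1},\bm\mu_{k+1})\leftarrow(\bm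 z,\bm\nu,\bm\eta)$, $e_{k+1}\leftarrow\min\{E_1(\bm x_{k+1},\bm\lambda_{k+1},\bm\mu_{k+1}),e_k\}$, $q_{k+1}\leftarrow q_k$, $k\leftarrow k+1$. The algorithm terminates and returns the current iterate when a while-condition of a phase fails. **Modified PASA and its phase-one search directions.** It is applied to $\min\{\mathcal L_q(\bm x,\bm\nu):\bm x\in\Omega\}$ from a starting guess $\bm u$: $\bm u_0=\bm u$, $\bm u_1$ is the projection of $\bm u_0$ onto $\Omega$. Put $\mathcal E(\bm v)=E_{m,0}(\bm v,\bm\nu+2q\bm h(\bm v),\bm\mu(\bm v,1))$; $e(\bm v)$ is the norm of the orthogonal projection of $\bm g(\bm v)$ onto the null space of $\bm A_{\mathcal A(\bm v)}$; and, with $E(\bm v)=\|\bm y(\bm v,1)-\bm v\|$ and fixed exponents $a\in(0,1)$, $c\in(1,2)$, $\mathcal U(\bm v)=\{i:\mu_i(\bm v,1)\ge E(\bm v)^a,\ -r_i(\bm v)\ge E(\bm v)^c\}$. The algorithm has parameters $\theta_P,\gamma_P\in(0,1)$. Phase one repeats: perform a gradient projection step $\bm u_{i+1}=\bm u_i+s_i\bm d_i$ with search direction $\bm d_i=\bm y(\bm u_i,\varsigma)-\bm u_i$ ($\varsigma>0$ fixed) and $s_i=\eta_P^{\,j}$, $j\ge0$ the smallest integer with $\mathcal L_q(\bm u_i+\eta_P^{\,j}\bm d_i,\bm\nu)\le\mathcal L_q(\bm u_i,\bm\nu)+\eta_P^{\,j}\delta_P\,\bm g(\bm u_i)^{\intercal}\bm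 d_i$ ($\delta_P,\eta_P\in(0,1)$ fixed); $i\leftarrow i+1$; if $\mathcal U(\bm u_i)=\emptyset$ and $e(\bm u_i)<\theta_P\mathcal E(\bm u_i)$, replace $\theta_P$ by $\gamma_P\theta_P$; if $e(\bm u_i)\ge\theta_P\mathcal E(\bm u_i)$, go to phase two. Phase two repeats: perform a step of a linearly constrained optimizer (producing feasible iterates with non-increasing objective and non-decreasing active sets, and such that $\liminf e(\bm u_i)=0$ if it is run forever with an eventually constant active set), $i\leftarrow i+1$; if $e(\bm u_i)<\theta_P\mathcal E(\bm u_i)$, go to phase one. Stop when $\mathcal E(\bm u_i)$ is at most the tolerance. Let $\mathcal D(\bm u,\bm\nu,q)$ be the set of all search directions $\bm d_i$ generated in phase one of this run. **Conditions (G1), (G2) at $(\bm u,\bm\nu,q)$.** Let $\mathcal S(\bm u,\bm\nu,q)=\{\bm x\in\Omega:\mathcal L_q(\bm x,\bm\nu)\le\mathcal L_q(\bm u,\bm\nu)\}$. - (G1) $\mathcal L_q(\cdot,\bm\nu)$ is bounded from below on $\mathcal S(\bm u,\bm\nu,q)$ and $d_{\max}=\sup_{\bm d\in\mathcal D(\bm u,\bm\nu,q)}\|\bm d\|<\infty$. - (G2) If $\overline{\mathcal S}(\bm u,\bm\nu,q)$ is the set of $\bm x\in\Omega$ whose distance to $\mathcal S(\bm u,\bm\nu,q)$ is at most $d_{\max}$, then $\nabla_x\mathcal L_q(\cdot,\bm\nu)$ is Lipschitz continuous on $\overline{\mathcal S}(\bm u,\bm\nu,q)$. *)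

(* Defs.v *)
From HB Require Import structures.
From mathcomp Require Import all_boot all_order all_algebra.
From mathcomp Require Import all_classical all_reals all_analysis.

Set Implicit Arguments.
Unset Strict Implicit.
Unset Printing Implicit Defensive.

Import Order.TTheory GRing.Theory Num.Theory.
Import numFieldNormedType.Exports.

Local Open Scope classical_set_scope.
Local Open Scope ring_scope.

(* Points and multipliers are row vectors, because the library's calculus on
   R^n ('J, EVT_min_rV) is developed for 'rV[R]_n.  The library norm `|v| on
   matrices is the sup norm, so the Euclidean norm is introduced here; both
   norms induce the topology used for limits, continuity and compactness. *)

Section vectors.
Variable R : realType.

Definition dot k (u v : 'rV[R]_k) : R := \sum_i u 0 i * v 0 i.

Definition sqnorm k (v : 'rV[R]_k) : R := dot v v.

Definition enorm k (v : 'rV[R]_k) : R := Num.sqrt (sqnorm v).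

Definition nonneg k (v : 'rV[R]_k) : Prop := forall i, 0 <= v 0 i.

Definition box_proj k (lo hi : R) (v : 'rV[R]_k) : 'rV[R]_k :=
  \row_i Num.max lo (Num.min (v 0 i) hi).

Definition cmin k (s t : 'rV[R]_k) : 'rV[R]_k :=
  \row_i Num.min (s 0 i) (t 0 i).

Definition argmin T (D : set T) (F : T -> R) : set T :=
  [set x | D x /\ forall y, D y -> F x <= F y].

Definition null_proj k m (M : 'M[R]_(m, k)) (v : 'rV[R]_k) : 'rV[R]_k :=
  get [set p | p *m M^T = 0 /\
               forall z : 'rV[R]_k, z *m M^T = 0 -> dot (v - p) z = 0].

Definition grad n (F : 'rV[R]_n -> R) (x : 'rV[R]_n) : 'rV[R]_n :=
  \row_j 'D_(delta_mx 0 j) F x.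

(* Since R^n is finite dimensional, continuity of x |-> 'd F x is the same as
   continuity of x |-> 'd F x v for every v. *)
Definition C1_on n (V : normedModType R) (D : set 'rV[R]_n)
    (F : 'rV[R]_n -> V) : Prop :=
  (forall x, D x -> differentiable F x) /\
  (forall v, {within D, continuous (fun x => 'd F x v)}).

Definition subseq_limit (T : topologicalType) (u : nat -> T) (l : T) : Prop :=
  exists2 phi : nat -> nat, {homo phi : i j / (i < j)%N} &
    u (phi i) @[i --> \oo] --> l.

Definition backtracking (rho : R) (accept : R -> Prop) (s : R) : Prop :=
  exists j : nat, [/\ s = rho ^+ j, accept (rho ^+ j) &
    forall i : nat, (i < j)%N -> ~ accept (rho ^+ i)].

End vectors.

Record problem (R : realType) (n m l : nat) := Problem {
  obj : 'rV[R]_n -> R;                (* f *)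
  eqc : 'rV[R]_n -> 'rV[R]_l;         (* h *)
  matA : 'M[R]_(m, n);                (* A *)
  vecb : 'rV[R]_m                     (* b *)
}.

Record iterate (R : realType) (n m l : nat) := Iterate {
  it_x : 'rV[R]_n;
  it_lam : 'rV[R]_l;
  it_mu : 'rV[R]_m
}.

Section estimators.
Variables (R : realType) (n m l : nat) (P : problem R n m l).

Definition resid (x : 'rV[R]_n) : 'rV[R]_m := x *m (matA P)^T - vecb P.

Definition Omega : set 'rV[R]_n := [set x | forall i, resid x 0 i <= 0].

(* The Jacobian of h in the l x n convention; the library's 'J acts on row
   vectors from the right, hence the transpose. *)
Definition Dh (x : 'rV[R]_n) : 'M[R]_(l, n) := ('J (eqc P) x)^T.

Definition active (x : 'rV[R]_n) : {set 'I_m} := [set i | resid x 0 i == 0].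

Definition active_rows (x : 'rV[R]_n) : 'M[R]_(#|active x|, n) :=
  rowsub (@enum_val _ (mem (active x))) (matA P).

Definition lagr (x : 'rV[R]_n) (lam : 'rV[R]_l) (mu : 'rV[R]_m) : R :=
  obj P x + dot lam (eqc P x) + dot mu (resid x).

Definition lagr_q (q : R) (x : 'rV[R]_n) (lam : 'rV[R]_l) : R :=
  obj P x + dot lam (eqc P x) + q * sqnorm (eqc P x).

Definition grad_lagr (x : 'rV[R]_n) (lam : 'rV[R]_l) (mu : 'rV[R]_m) :
    'rV[R]_n :=
  grad (fun z => lagr z lam mu) x.

Definition Em0 (x : 'rV[R]_n) (lam : 'rV[R]_l) (mu : 'rV[R]_m) : R :=
  sqnorm (grad_lagr x lam mu) - dot mu (resid x).

Definition Em1 (x : 'rV[R]_n) (lam : 'rV[R]_l) (mu : 'rV[R]_m) : R :=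
  sqnorm (grad_lagr x lam mu) + sqnorm (cmin (- resid x) mu).

Definition Ec (x : 'rV[R]_n) : R := sqnorm (eqc P x).

Definition E1 (t : iterate R n m l) : R :=
  Num.sqrt (Em1 (it_x t) (it_lam t) (it_mu t) + Ec (it_x t)).

End estimators.

Inductive phase := PhaseOne | PhaseTwo.

Record pasa_params (R : realType) := PasaParams {
  pa_theta : R;                       (* theta_P, initial value *)
  pa_gamma : R;                       (* gamma_P *)
  pa_a : R;                           (* a *)
  pa_c : R;                           (* c *)
  pa_step : R;                        (* varsigma *)
  pa_delta : R;                       (* delta_P *)
  pa_eta : R;                         (* eta_P *)
  pa_tol : R                          (* stopping tolerance *)
}.

Definition pasa_params_ok (R : realType) (pp : pasa_params R) : Prop :=
  [/\ 0 < pa_theta pp < 1, 0 < pa_gamma pp < 1, 0 < pa_a pp < 1 &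
      1 < pa_c pp < 2] /\
  [/\ 0 < pa_step pp, 0 < pa_delta pp < 1, 0 < pa_eta pp < 1 &
      0 <= pa_tol pp].

(* The trace of a run.  Iterates are pa_u 0, pa_u 1, ...; [pa_last] is the
   index of the final one, or None for an infinite run.  [pa_mult i] is the
   multiplier mu(u_i, 1), which need not be unique.  [pa_phase i] and
   [pa_th i] are the phase in control and the current value of theta_P once
   u_i has been computed and tested, so that u_(i+1) is generated in phase
   [pa_phase i].  Entries past [pa_last], and the entries of index 0 of
   [pa_mult], [pa_phase] and [pa_th], are irrelevant. *)
Record pasa_run (R : realType) (n m : nat) := PasaRun {
  pa_last : option nat;
  pa_u : nat -> 'rV[R]_n;
  pa_mult : nat -> 'rV[R]_m;
  pa_phase : nat -> phase;
  pa_th : nat -> R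
}.

Section pasa.
Variables (R : realType) (n m l : nat) (P : problem R n m l).
Variables (nu : 'rV[R]_l) (q : R).

Definition grad_q (x : 'rV[R]_n) : 'rV[R]_n :=
  grad (fun z => lagr_q P q z nu) x.

Definition ypt (x : 'rV[R]_n) (alpha : R) : 'rV[R]_n :=
  get (argmin (Omega P)
    (fun y => 2%:R^-1 * sqnorm (x - alpha *: grad_q x - y))).

Definition is_proj_mult (x : 'rV[R]_n) (alpha : R) (mu : 'rV[R]_m) : Prop :=
  [/\ nonneg mu,
      ypt x alpha - x + alpha *: grad_q x + mu *m matA P = 0 &
      forall i, mu 0 i * resid P (ypt x alpha) 0 i = 0].

Definition pasa_E (v : 'rV[R]_n) (mu : 'rV[R]_m) : R :=
  Em0 P v (nu + (2%:R * q) *: eqc P v) mu.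

Definition pasa_e (v : 'rV[R]_n) : R :=
  enorm (null_proj (active_rows P v) (grad_q v)).

Definition undecided (pp : pasa_params R) (v : 'rV[R]_n) (mu : 'rV[R]_m) :
    {set 'I_m} :=
  let E := enorm (ypt v 1 - v) in
  [set i | (E `^ pa_a pp <= mu 0 i) && (E `^ pa_c pp <= - resid P v 0 i)].

Definition pasa_index (run : pasa_run R n m) : set nat :=
  [set i | if pa_last run is Some N then (i <= N)%N else true].

Definition pasa_dir (pp : pasa_params R) (v : 'rV[R]_n) : 'rV[R]_n :=
  ypt v (pa_step pp) - v.

Definition pasa_phase_one_step (pp : pasa_params R) (run : pasa_run R n m)
    (i : nat) : Prop :=
  let u := pa_u run i in
  let d := pasa_dir pp u in
  let armijo s := lagr_q P q (u + s *: d) nu <=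
                  lagr_q P q u nu + s * pa_delta pp * dot (grad_q u) d in
  let u' := pa_u run i.+1 in
  let mu' := pa_mult run i.+1 in
  [/\ exists2 s, backtracking (pa_eta pp) armijo s & u' = u + s *: d,
      pa_th run i.+1 =
        (if (undecided pp u' mu' == finset.set0) &&
            (pasa_e u' < pa_th run i * pasa_E u' mu')
         then pa_gamma pp * pa_th run i else pa_th run i) &
      pa_phase run i.+1 =
        (if pa_th run i.+1 * pasa_E u' mu' <= pasa_e u'
         then PhaseTwo else PhaseOne)].

Definition pasa_phase_two_step (run : pasa_run R n m) (i : nat) : Prop :=
  let u := pa_u run i in
  let u' := pa_u run i.+1 in
  let mu' := pa_mult run i.+1 in
  [/\ [/\ Omega P u', lagr_q P q u' nu <= lagr_q P q u nu &
          active P u \subset active P u'],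
      pa_th run i.+1 = pa_th run i &
      pa_phase run i.+1 =
        (if pasa_e u' < pa_th run i.+1 * pasa_E u' mu'
         then PhaseOne else PhaseTwo)].

(* Part of the specification of the optimizer used in phase two: it constrains
   the whole run, not a single step. *)
Definition lco_property (run : pasa_run R n m) : Prop :=
  pa_last run = None ->
  (exists N : nat, forall i, (N <= i)%N ->
     pa_phase run i = PhaseTwo /\
     active P (pa_u run i) = active P (pa_u run N)) ->
  limn_einf (fun i => (pasa_e (pa_u run i))%:E) = 0%E.

Definition is_pasa_run (pp : pasa_params R) (u0 : 'rV[R]_n)
    (run : pasa_run R n m) : Prop :=
  [/\ [/\ pa_u run 0%N = u0,
          pa_u run 1%N =
            get (argmin (Omega P) (fun y => 2%:R^-1 * sqnorm (u0 - y))),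
          pa_phase run 1%N = PhaseOne & pa_th run 1%N = pa_theta pp],
      forall i, (0 < i)%N -> pasa_index run i ->
        is_proj_mult (pa_u run i) 1 (pa_mult run i),
      forall i, (0 < i)%N -> pasa_index run i.+1 ->
        pa_tol pp < pasa_E (pa_u run i) (pa_mult run i) /\
        match pa_phase run i with
        | PhaseOne => pasa_phase_one_step pp run i
        | PhaseTwo => pasa_phase_two_step run i
        end,
      forall N, pa_last run = Some N ->
        (0 < N)%N /\ pasa_E (pa_u run N) (pa_mult run N) <= pa_tol pp &
      lco_property run].

(* The point computed by a run: the final iterate, or for an infinite run some
   subsequential limit point of the iterates. *)
Definition pasa_result (run : pasa_run R n m) (x : 'rV[R]_n) : Prop :=
  match pa_last run with
  | Some N => x = pa_u run N
  | None => subseq_limit (pa_u run) x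
  end.

Definition pasa_dirs (pp : pasa_params R) (run : pasa_run R n m) :
    set 'rV[R]_n :=
  [set pasa_dir pp (pa_u run i) | i in
    [set i | [/\ (0 < i)%N, pasa_index run i.+1 &
                 pa_phase run i = PhaseOne]]].

Definition level_set (u : 'rV[R]_n) : set 'rV[R]_n :=
  [set x | Omega P x /\ lagr_q P q x nu <= lagr_q P q u nu].

(* The supremum over an empty set of directions is 0 ([sup set0 = 0]). *)
Definition dmax (pp : pasa_params R) (run : pasa_run R n m) : R :=
  sup [set enorm d | d in pasa_dirs pp run].

Definition condG1 (pp : pasa_params R) (u : 'rV[R]_n)
    (run : pasa_run R n m) : Prop :=
  has_lbound [set lagr_q P q x nu | x in level_set u] /\
  has_ubound [set enorm d | d in pasa_dirs pp run].

Definition level_nbhd (pp : pasa_params R) (u : 'rV[R]_n)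
    (run : pasa_run R n m) : set 'rV[R]_n :=
  [set x | Omega P x /\
           inf [set enorm (x - s) | s in level_set u] <= dmax pp run].

Definition condG2 (pp : pasa_params R) (u : 'rV[R]_n)
    (run : pasa_run R n m) : Prop :=
  exists K : R, forall x y, level_nbhd pp u run x -> level_nbhd pp u run y ->
    enorm (grad_q x - grad_q y) <= K * enorm (x - y).

End pasa.

Record npasa_params (R : realType) := NpasaParams {
  np_eps : R;
  np_theta : R;
  np_phi : R;
  np_lambar : R;
  np_q0 : R;
  np_alpha : R;
  np_beta : R;
  np_sigma : R;
  np_tau : R;
  np_p : R;
  np_delta : R;
  np_gamma : R;
  np_pasa : pasa_params R
}.

Definition npasa_params_ok (R : realType) (c : npasa_params R) : Prop :=
  [/\ 0 <= np_eps c, 0 < np_theta c < 1, 1 < np_phi c, 0 < np_lambar c &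
      1 <= np_q0 c] /\
  [/\ 0 < np_alpha c <= 1, 1 <= np_beta c, 0 < np_sigma c < 1 &
      0 < np_tau c < 1] /\
  [/\ 1 < np_p c, 0 < np_delta c < 1, 0 < np_gamma c &
      pasa_params_ok (np_pasa c)].

Section npasa.
Variables (R : realType) (n m l : nat) (P : problem R n m l).
Variable c : npasa_params R.

Definition lam_proj (lam : 'rV[R]_l) : 'rV[R]_l :=
  box_proj (- np_lambar c) (np_lambar c) lam.

Definition GS (t : iterate R n m l) (q : R) (run : pasa_run R n m)
    (t' : iterate R n m l) : Prop :=
  let lamb := lam_proj (it_lam t) in
  [/\ is_pasa_run P lamb q (np_pasa c) (it_x t) run /\
        pasa_result run (it_x t'),
      argmin (Omega P) (fun x => lagr_q P q x lamb) (it_x t'),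
      it_lam t' = lamb + (2%:R * q) *: eqc P (it_x t') &
      is_proj_mult P lamb q (it_x t') 1 (it_mu t')].

Definition cs_subproblem (p : R) (w wbar : 'rV[R]_n) (y : 'rV[R]_l) : Prop :=
  Num.max (np_beta c ^+ 2) (enorm (eqc P w) ^- 2) <= p /\
  argmin [set wy : 'rV[R]_n * 'rV[R]_l |
            (wy.1 - w) *m (Dh P w)^T + wy.2 = - eqc P w /\ Omega P wy.1]
         (fun wy => sqnorm (wy.1 - w) + p * sqnorm wy.2) (wbar, y).

Definition cs_accept (w wbar : 'rV[R]_n) (alpha' s : R) : Prop :=
  enorm (eqc P (w + s *: (wbar - w))) <=
  (1 - np_tau c * alpha' * s) * enorm (eqc P w).

(* [constraint_step thr w res]: the loop of the constraint step, with
   threshold [thr] = theta * Em1(x, lam, mu) and current point w, ends with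
   [res]; None stands for the premature exit from LS. *)
Inductive constraint_step (thr : R) :
    'rV[R]_n -> option 'rV[R]_n -> Prop :=
| cs_done w :
    Ec P w <= thr -> constraint_step thr w (Some w)
| cs_fail w p wbar y :
    thr < Ec P w -> cs_subproblem p w wbar y ->
    1 - enorm y < np_alpha c -> constraint_step thr w None
| cs_next w p wbar y s res :
    thr < Ec P w -> cs_subproblem p w wbar y ->
    np_alpha c <= 1 - enorm y ->
    backtracking (np_sigma c) (cs_accept w wbar (1 - enorm y)) s ->
    constraint_step thr (w + s *: (wbar - w)) res ->
    constraint_step thr w res.

(* (nu, eta') are admissible multipliers nu_i, eta'_i at the point z = z_i. *)
Definition ms_multipliers (z : 'rV[R]_n) (nu : 'rV[R]_l) (eta' : 'rV[R]_m) :
    Prop :=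
  exists2 eta : 'rV[R]_m,
    argmin [set ne : 'rV[R]_l * 'rV[R]_m | nonneg ne.2]
           (fun ne => Em0 P z ne.1 ne.2
                      + np_gamma c * sqnorm (row_mx ne.1 ne.2)) (nu, eta) &
    argmin [set et : 'rV[R]_m | nonneg et] (fun et => Em1 P z nu et) eta'.

Definition ms_subproblem (p : R) (z : 'rV[R]_n) (nu : 'rV[R]_l)
    (z' : 'rV[R]_n) : Prop :=
  argmin [set x | (x - z) *m (Dh P z)^T = 0 /\ Omega P x]
         (fun x => obj P x + dot nu (eqc P x)
                   + p * sqnorm (eqc P x - eqc P z)) z'.

(* [multiplier_step thr p z nu eta' res]: the loop of the multiplier step, with
   threshold [thr] = theta * Ec(w), current penalty p and current triple
   (z_i, nu_i, eta'_i), ends with [res].  "Increase the penalty if necessary"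
   is rendered by an arbitrary p' >= p. *)
Inductive multiplier_step (thr : R) :
    R -> 'rV[R]_n -> 'rV[R]_l -> 'rV[R]_m ->
    option (iterate R n m l) -> Prop :=
| ms_done p z nu eta' :
    Em1 P z nu eta' <= thr ->
    multiplier_step thr p z nu eta' (Some (Iterate z nu eta'))
| ms_fail p p' z nu eta' z1 nu1 eta1' :
    thr < Em1 P z nu eta' -> p <= p' -> ms_subproblem p' z nu z1 ->
    ms_multipliers z1 nu1 eta1' ->
    np_delta c * Em1 P z nu eta' < Em1 P z1 nu1 eta1' ->
    multiplier_step thr p z nu eta' None
| ms_next p p' z nu eta' z1 nu1 eta1' res :
    thr < Em1 P z nu eta' -> p <= p' -> ms_subproblem p' z nu z1 ->
    ms_multipliers z1 nu1 eta1' ->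
    Em1 P z1 nu1 eta1' <= np_delta c * Em1 P z nu eta' ->
    multiplier_step thr p' z1 nu1 eta1' res ->
    multiplier_step thr p z nu eta' res.

Definition LS (t t' : iterate R n m l) : Prop :=
  exists2 rw : option 'rV[R]_n,
    constraint_step (np_theta c * Em1 P (it_x t) (it_lam t) (it_mu t))
      (it_x t) rw &
    match rw with
    | None => t' = t
    | Some w =>
        exists nu0 eta0' res,
        [/\ ms_multipliers w nu0 eta0',
            multiplier_step (np_theta c * Ec P w) (np_p c) w nu0 eta0' res &
            t' = odflt t res]
    end.

End npasa.

(* The trace of an infinite execution.  [nr_it k] is (x_k, lam_k, mu_k).
   [nr_arr k] is the phase in control when iterate k has just been computed;
   [nr_gen k] is the phase in which iterate k.+1 is generated (the two differ
   when phase two gives up at iterate k and returns to phase one).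
   [nr_q k] is the value of q_k after any update made on entering phase one
   at iterate k, i.e. the value with which iterate k.+1 is generated.
   [nr_pasa k] is the PASA run computing iterate k.+1 when this is done by a
   global step. *)
Record npasa_run (R : realType) (n m l : nat) := NpasaRun {
  nr_it : nat -> iterate R n m l;
  nr_q : nat -> R;
  nr_e : nat -> R;
  nr_arr : nat -> phase;
  nr_gen : nat -> phase;
  nr_pasa : nat -> pasa_run R n m
}.

Section npasa_execution.
Variables (R : realType) (n m l : nat) (P : problem R n m l).
Variables (c : npasa_params R) (run : npasa_run R n m l).

Definition nr_x (k : nat) : 'rV[R]_n := it_x (nr_it run k).
Definition nr_lam (k : nat) : 'rV[R]_l := it_lam (nr_it run k).
Definition nr_mu (k : nat) : 'rV[R]_m := it_mu (nr_it run k).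

(* The choice of the phase generating iterate k.+1, and of q_k.  As
   [nr_arr 0 = PhaseOne], the second case only occurs for k > 0. *)
Definition npasa_control (k : nat) : Prop :=
  match nr_arr run k with
  | PhaseOne => nr_gen run k = PhaseOne /\ nr_q run k = nr_q run k.-1
  | PhaseTwo =>
      exists2 t, LS P c (nr_it run k) t &
        if np_theta c * E1 P (nr_it run k) < E1 P t then
          nr_gen run k = PhaseOne /\
          nr_q run k =
            Num.max (np_phi c) (nr_e run k.-1)^-1 * nr_q run k.-1
        else
          [/\ nr_gen run k = PhaseTwo, nr_q run k = nr_q run k.-1 &
              nr_it run k.+1 = t]
  end.

Definition npasa_advance (k : nat) : Prop :=
  match nr_gen run k with
  | PhaseOne =>
      GS P c (nr_it run k) (nr_q run k) (nr_pasa run k) (nr_it run k.+1) /\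
      nr_arr run k.+1 =
        (if Em1 P (nr_x k.+1) (nr_lam k.+1) (nr_mu k.+1)
              <= np_theta c * Ec P (nr_x k.+1)
         then PhaseTwo else PhaseOne)
  | PhaseTwo => nr_arr run k.+1 = PhaseTwo
  end.

Definition is_npasa_run : Prop :=
  [/\ nr_arr run 0%N = PhaseOne, nr_q run 0%N = np_q0 c &
      nr_e run 0%N = E1 P (nr_it run 0%N)] /\
  forall k : nat,
  [/\ np_eps c < E1 P (nr_it run k), npasa_control k, npasa_advance k &
      nr_e run k.+1 = Num.min (E1 P (nr_it run k.+1)) (nr_e run k)].

(* S_1 and S_2 contain positive indices only: iterate 0 is an input. *)
Definition generated_in (j : phase) : set nat :=
  [set k | (0 < k)%N /\ nr_gen run k.-1 = j].

End npasa_execution.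

(* Main.v *)
Require Import Defs.
From HB Require Import structures.
From mathcomp Require Import all_boot all_order all_algebra.
From mathcomp Require Import all_classical all_reals all_analysis.
From mathcomp Require Import ring lra.

(** At a global minimizer x' of L_q over the polyhedron, first-order optimality
    says that x' is the projection of x' - g(x') onto the polyhedron.  The KKT
    system of that projection, with multiplier mu', is then the stationarity and
    complementarity system of the original problem at (x', lam', mu') with
    lam' = nu + 2 q h(x'), because 2 q h(x') is what the penalty adds to the
    multiplier in the gradient of L_q.  Hence E_{m,1} = 0 after every global step
    ([Em1_global_step]).  Two things follow: E_1 = |h(x')| there, and NPASA always
    passes from phase one to phase two after a single step.

    If only finitely many iterates are generated in phase one, then E_1 is
    multiplied by at most theta < 1 at every later step and tends to 0.

    Otherwise NPASA returns to phase one infinitely often, and each return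
    multiplies the penalty q by at least phi > 1, so q -> oo ([penalty_unbounded]).  By
    compactness a subsequence of the points computed by global steps converges to
    some xs.  Since these points minimize f + nu.h + q |h|^2 with bounded nu, the
    limit xs minimizes |h|^2 over the polyhedron.  If h(xs) were nonzero, the rank
    condition would give a direction d with Dh(xs) d = - h(xs) that is tangent to
    the active constraints; it is feasible and |h|^2 decreases along it, a
    contradiction ([Ec_stationary]).  So h(xs) = 0, and E_1 = |h| tends to 0 along
    the subsequence ([penalty_limit_feasible]). *)

Set Implicit Arguments.
Unset Strict Implicit.
Unset Printing Implicit Defensive.

Import Order.TTheory GRing.Theory Num.Theory.
Import numFieldNormedType.Exports.

Local Open Scope classical_set_scope.
Local Open Scope ring_scope.

(** * The Euclidean inner product *)

Section inner_product.
Variable R : realType.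

Lemma dotC k (u v : 'rV[R]_k) : dot u v = dot v u.
Proof. by apply: eq_bigr => i _; rewrite mulrC. Qed.

Lemma dotDl k (u v w : 'rV[R]_k) : dot (u + v) w = dot u w + dot v w.
Proof. by rewrite -big_split; apply: eq_bigr => i _; rewrite mxE mulrDl. Qed.

Lemma dotZl k (a : R) (u v : 'rV[R]_k) : dot (a *: u) v = a * dot u v.
Proof. by rewrite mulr_sumr; apply: eq_bigr => i _; rewrite mxE mulrA. Qed.

Lemma dotNl k (u v : 'rV[R]_k) : dot (- u) v = - dot u v.
Proof. by rewrite -scaleN1r dotZl mulN1r. Qed.

Lemma dot0l k (v : 'rV[R]_k) : dot 0 v = 0.
Proof. by rewrite -(scale0r 0) dotZl mul0r. Qed.

Lemma dotBr k (u v w : 'rV[R]_k) : dot w (u - v) = dot w u - dot w v.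
Proof. by rewrite dotC dotDl dotNl !(dotC w). Qed.

Lemma dot_mulmx_tr k p (u : 'rV[R]_k) (M : 'M[R]_(p, k)) (v : 'rV[R]_p) :
  dot (u *m M^T) v = dot u (v *m M).
Proof.
rewrite /dot.
under eq_bigr do rewrite mxE mulr_suml.
rewrite exchange_big /=; apply: eq_bigr => j _.
rewrite mxE mulr_sumr; apply: eq_bigr => i _.
by rewrite !mxE mulrAC mulrA.
Qed.

Lemma dot_delta k (u : 'rV[R]_k) j : dot u (delta_mx 0 j) = u 0 j.
Proof.
rewrite /dot (bigD1 j)//= mxE !eqxx mulr1 big1 ?addr0// => i ij.
by rewrite mxE (negbTE ij) andbF mulr0.
Qed.

Lemma sqnorm_ge0 k (u : 'rV[R]_k) : 0 <= sqnorm u.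
Proof. by apply: sumr_ge0 => i _; rewrite -expr2 sqr_ge0. Qed.

Lemma sqnorm_eq0 k (u : 'rV[R]_k) : sqnorm u = 0 -> u = 0.
Proof.
move=> /eqP; rewrite psumr_eq0 => [/allP u0|i _]; last first.
  by rewrite -expr2 sqr_ge0.
apply/rowP => i; rewrite mxE; apply/eqP; rewrite -sqrf_eq0 expr2.
by apply: (implyP (u0 i _)) => //; rewrite mem_index_enum.
Qed.

(** Young's inequality, which separates u from v: the multiplier and the
    constraint values can then be bounded independently. *)
Lemma norm_dot_le k (u v : 'rV[R]_k) :
  `|dot u v| <= 2%:R^-1 * (sqnorm u + sqnorm v).
Proof.
rewrite /sqnorm /dot -big_split mulr_sumr/=.
apply: le_trans (ler_norm_sum _ _ _) _; apply: ler_sum => i _.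
rewrite ler_norml; apply/andP; split.
  by have := sqr_ge0 (u 0 i + v 0 i); rewrite expr2; lra.
by have := sqr_ge0 (u 0 i - v 0 i); rewrite expr2; lra.
Qed.

Lemma sqnorm_box_proj k (b : R) (v : 'rV[R]_k) :
  0 <= b -> sqnorm (box_proj (- b) b v) <= k%:R * b ^+ 2.
Proof.
move=> b0; rewrite mulr_natl -[X in _ *+ X](card_ord k) -sumr_const.
apply: ler_sum => i _; rewrite mxE; set w := Num.max _ _.
have lo : - b <= w by rewrite le_max lexx.
have hi : w <= b by rewrite ge_max ge_min lexx orbT andbT; lra.
nra.
Qed.

Lemma cvg_dot (T : Type) (F : set_system T) {FF : Filter F} k
    (f g : T -> 'rV[R]_k) (a b : 'rV[R]_k) :
  f @ F --> a -> g @ F --> b -> dot (f x) (g x) @[x --> F] --> dot a b.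
Proof.
move=> fa gb; rewrite /dot.
have -> : (fun x => \sum_i f x 0 i * g x 0 i) =
          \sum_i (fun x => f x 0 i * g x 0 i).
  by apply/funext => x; rewrite fct_sumE.
have coord (h : T -> 'rV[R]_k) (c : 'rV[R]_k) i :
    h @ F --> c -> h x 0 i @[x --> F] --> c 0 i.
  by move=> hc; exact: (cvg_comp _ _ hc (@coord_continuous _ _ _ 0 i c)).
elim/big_ind2 : _ => [|h h' ? ? ? ?|i _]; [|exact: cvgD|].
  exact: (cvg_cst (0 : R)).
by apply: cvgM; exact: coord.
Qed.

End inner_product.

(** * Gradients *)

Section gradients.
Variable R : realType.

Lemma is_derive_dot (V : normedModType R) k (f g : V -> 'rV[R]_k) (x v : V)
    (df dg : 'rV[R]_k) :
  is_derive x v f df -> is_derive x v g dg ->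
  is_derive x v (fun z => dot (f z) (g z)) (dot df (g x) + dot (f x) dg).
Proof.
have coord (h : V -> 'rV[R]_k) dh i : is_derive x v h dh ->
    is_derive x v (fun z => h z 0 i) (dh 0 i).
  move=> [hv <-]; have /derivable_mxP hvi := hv.
  by rewrite derive_mx// mxE; exact: derivableP.
move=> fx gx.
have -> : (fun z => dot (f z) (g z)) =
          \sum_i ((fun z => f z 0 i) * (fun z => g z 0 i)).
  by apply/funext => z; rewrite fct_sumE.
apply: (is_derive_eq (is_derive_sum (fun i =>
  is_deriveM (coord _ _ i fx) (coord _ _ i gx)))).
rewrite big_split/= addrC /dot; congr (_ + _); apply: eq_bigr => i _.
by rewrite /GRing.scale/= mulrC.
Qed.

(** This computes a gradient from a single formula for all the directional
    derivatives, without a separate proof of differentiability. *)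
Lemma grad_of_is_derive n (F : 'rV[R]_n -> R) (x g : 'rV[R]_n) :
  (forall v, is_derive x v F (dot g v)) -> grad F x = g.
Proof.
by move=> Fx; apply/rowP => j; rewrite mxE derive_val dot_delta.
Qed.

(** Differentiability makes the derivative linear in the direction, so that the
    partial derivatives gathered in the gradient determine it. *)
Lemma is_derive_grad n (F : 'rV[R]_n -> R) (x v : 'rV[R]_n) :
  differentiable F x -> is_derive x v F (dot (grad F x) v).
Proof.
move=> Fx; apply: DeriveDef; first exact: diff_derivable.
rewrite deriveE// [in LHS](row_sum_delta v) linear_sum/=.
apply: eq_bigr => j _; rewrite linearZ/= mxE deriveE//.
by rewrite /GRing.scale/= mulrC.
Qed.

(** Only the values of F on a short ray from x matter, so the lemma applies to
    minimizers over a set at every point from which v is a feasible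
    direction. *)
Lemma derive_ge0_at_min (V : normedModType R) (F : V -> R) (x v : V) (dF : R) :
  is_derive x v F dF -> (\forall t \near 0^'+, F x <= F (x + t *: v)) ->
  0 <= dF.
Proof.
move=> [Fx <-] Fmin.
have Fxr : h^-1 *: (F (h *: v + x) - F x) @[h --> 0^'+] --> 'D_v F x.
  exact: cvg_dnbhs_at_right.
rewrite -(cvg_lim _ Fxr)//; apply: limr_ge; first exact: (cvgP _ Fxr).
near=> t; apply: mulr_ge0.
  by rewrite invr_ge0 ltW//; near: t; exact: nbhs_right_gt.
by rewrite subr_ge0 addrC; near: t.
Unshelve. all: by end_near. Qed.

End gradients.

(** * Subsequences and lower limits *)

(** The indices are chosen one after the other, each beyond the previous one. *)
Lemma frequently_subseq (Q : nat -> nat -> Prop) :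
  (forall i N, exists2 k, (N <= k)%N & Q i k) ->
  exists2 phi : nat -> nat, {homo phi : i j / (i < j)%N} &
    forall i, Q i (phi i).
Proof.
move=> HQ; pose next i N := projT1 (cid2 (HQ i N)).
have nextP i N : (N <= next i N)%N /\ Q i (next i N).
  by rewrite /next; case: cid2.
pose phi := fix phi i := if i is j.+1 then next i (phi j).+1 else next 0%N 0%N.
exists phi; last by case=> [|i]; apply: (nextP _ _).2.
by apply: homo_ltn => [? ? ?|i]; [exact: ltn_trans|exact: (nextP _ _).1].
Qed.

(** Enumerate S first: the values of u along S form a sequence in K, which has a
    cluster point l by compactness.  A second selection, in which the i-th term
    is within 1/(i+1) of l, turns the cluster point into a limit. *)
Lemma compact_subseq (R : realType) (V : pseudoMetricType R) (K : set V)
    (u : nat -> V) (S : set nat) :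
  compact K -> (forall k, S k -> K (u k)) ->
  (forall N, exists2 k, (N <= k)%N & S k) ->
  exists phi l, [/\ {homo phi : i j / (i < j)%N}, forall i, S (phi i), K l &
    u (phi i) @[i --> \oo] --> l].
Proof.
move=> Kc uK Sinf.
have [psi psi_incr psiS] := frequently_subseq (fun=> Sinf).
have [l [Kl ul]] : K `&` cluster ((u \o psi) @ \oo) !=set0.
  by apply: Kc; exists 0%N => // i _; exact/uK/psiS.
have [p p_incr pP] : exists2 phi : nat -> nat,
    {homo phi : i j / (i < j)%N} &
    forall i, ball l i.+1%:R^-1 (u (psi (phi i))).
  apply: (frequently_subseq
    (Q := fun i k => ball l i.+1%:R^-1 (u (psi k)))) => i N.
  have i0 : 0 < i.+1%:R^-1 :> R by rewrite invr_gt0.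
  have tailN : ((u \o psi) @ \oo) ((u \o psi) @` [set k | (N <= k)%N]).
    by exists N => // k /= Nk; exists k.
  have [_ [[k Nk <-] lk]] := ul _ _ tailN (nbhsx_ballx l _ i0).
  by exists k.
exists (psi \o p), l; split => // [i j ij|i|].
- exact/psi_incr/p_incr.
- exact: psiS.
apply/cvg_ballP => e e0; near=> i.
apply: le_ball (pP i); apply: ltW.
by near: i; exact: near_infty_natSinv_lt (PosNum e0).
Unshelve. all: by end_near. Qed.

Lemma limn_einf_eq0 (R : realType) (u : nat -> R) :
  (forall k, 0 <= u k) ->
  (forall e N, 0 < e -> exists2 k, (N <= k)%N & u k <= e) ->
  limn_einf (fun k => (u k)%:E) = 0%E.
Proof.
move=> u0 usmall; rewrite limn_einf_lim.
suff -> : einfs (fun k => (u k)%:E) = cst 0%E by apply: lim_cst.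
apply/funext => N; apply/eqP; rewrite eq_le; apply/andP; split.
  apply/lee_addgt0Pr => e /(usmall _ N)[k Nk uk].
  apply: (@le_trans _ _ (u k)%:E); last by rewrite add0e lee_fin.
  by apply: ereal_inf_lbound; exists k.
by apply: le_ereal_inf_tmp => _ [k _ <-]; rewrite lee_fin.
Qed.

(** * First-order conditions for the constrained problem *)

Section first_order.
Variables (R : realType) (n m l : nat) (P : problem R n m l).

Lemma resid_line (x v : 'rV[R]_n) (t : R) :
  resid P (x + t *: v) = resid P x + t *: (v *m (matA P)^T).
Proof. by rewrite /resid mulmxDl -scalemxAl addrAC. Qed.

Lemma dot_mul_matA (mu : 'rV[R]_m) (x y : 'rV[R]_n) :
  dot (mu *m matA P) (x - y) = dot mu (resid P x) - dot mu (resid P y).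
Proof.
rewrite -dotBr /resid opprB addrA subrK -mulmxBl.
by rewrite [RHS]dotC dot_mulmx_tr dotC.
Qed.

Lemma Omega_segment (x y : 'rV[R]_n) (t : R) :
  Omega P x -> Omega P y -> 0 <= t <= 1 -> Omega P (x + t *: (y - x)).
Proof.
move=> Ox Oy /andP[t0 t1] i; rewrite resid_line mulmxBl.
have := Ox i; have := Oy i; rewrite /resid !mxE => yi xi.
nra.
Qed.

Lemma is_derive_eqc (x v : 'rV[R]_n) : differentiable (eqc P) x ->
  is_derive x v (eqc P) (v *m (Dh P x)^T).
Proof.
move=> hx; apply: DeriveDef; first exact: diff_derivable.
by rewrite deriveEjacobian// trmxK.
Qed.

Lemma is_derive_Ec (x v : 'rV[R]_n) : differentiable (eqc P) x ->
  is_derive x v (Ec P) (2%:R * dot (eqc P x) (v *m (Dh P x)^T)).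
Proof.
move=> hx; have hd := is_derive_eqc v hx.
apply: (is_derive_eq (is_derive_dot hd hd)).
by rewrite (dotC _ (eqc P x)) mulr_natl mulr2n.
Qed.

(** The penalty term contributes to the derivative like a multiplier 2qh(x): this
    is why lam' = nu + 2qh(x') is the right update of the multiplier. *)
Lemma is_derive_lagr_q (nu : 'rV[R]_l) (q : R) (x v : 'rV[R]_n) :
  differentiable (obj P) x -> differentiable (eqc P) x ->
  is_derive x v (fun z => lagr_q P q z nu)
    (dot (grad (obj P) x + (nu + (2%:R * q) *: eqc P x) *m Dh P x) v).
Proof.
move=> fx hx; have hd := is_derive_eqc v hx.
have fd := is_derive_grad v fx.
have -> : (fun z => lagr_q P q z nu) =
    obj P + (fun z => dot (cst nu z) (eqc P z)) + q *: Ec P by [].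
apply: (is_derive_eq (is_deriveD (is_deriveD fd (is_derive_dot
  (is_derive_cst nu x v) hd)) (is_deriveZ q (is_derive_Ec v hx)))).
rewrite dot0l add0r dotDl mulmxDl dotDl -!addrA; congr (_ + _).
rewrite -scalemxAl dotZl -(trmxK (Dh P x)) !dot_mulmx_tr.
by rewrite /GRing.scale/= trmxK; ring.
Qed.

Lemma grad_qE (nu : 'rV[R]_l) (q : R) (x : 'rV[R]_n) :
  differentiable (obj P) x -> differentiable (eqc P) x ->
  grad_q P nu q x = grad (obj P) x + (nu + (2%:R * q) *: eqc P x) *m Dh P x.
Proof.
by move=> fx hx; apply: grad_of_is_derive => v; exact: is_derive_lagr_q.
Qed.

Lemma grad_lagrE (x : 'rV[R]_n) (lam : 'rV[R]_l) (mu : 'rV[R]_m) :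
  differentiable (obj P) x -> differentiable (eqc P) x ->
  grad_lagr P x lam mu = grad (obj P) x + lam *m Dh P x + mu *m matA P.
Proof.
move=> fx hx; apply: grad_of_is_derive => v.
have hd := is_derive_eqc v hx; have fd := is_derive_grad v fx.
have -> : (fun z => lagr P z lam mu) =
    obj P + (fun z => dot (cst lam z) (eqc P z)) +
    (fun z => dot (cst (mu *m matA P) z) z) + cst (- dot mu (vecb P)).
  apply/funext => z; rewrite /lagr /resid dotBr addrA.
  by rewrite [dot mu (z *m _)]dotC dot_mulmx_tr (dotC z).
apply: (is_derive_eq (is_deriveD (is_deriveD (is_deriveD fd (is_derive_dot
  (is_derive_cst lam x v) hd)) (is_derive_dot (is_derive_cst _ x v)
  (is_derive_id x v))) (is_derive_cst _ x v))).
rewrite !dot0l !add0r addr0 !dotDl /cst; congr (_ + _ + _).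
by rewrite dotC dot_mulmx_tr dotC.
Qed.

(** The projection is a chosen minimizer, which is a meaningless default when
    none exists; compactness of the polyhedron provides one. *)
Lemma ypt_feasible (nu : 'rV[R]_l) (q : R) (x : 'rV[R]_n) (alpha : R) :
  compact (Omega P) -> Omega P !=set0 -> Omega P (ypt P nu q x alpha).
Proof.
move=> Oc O0; set c := x - alpha *: grad_q P nu q x.
pose F y := 2%:R^-1 * sqnorm (c - y).
have Fcont : {within Omega P, continuous F}.
  apply: continuous_subspaceT => y.
  have cy : c - z @[z --> y] --> c - y.
    exact: (cvgB (cvg_cst c) (@cvg_id _ (nbhs y))).
  exact: (cvgM (cvg_cst (2%:R^-1 : R)) (cvg_dot cy cy)).
have [y yO ymin] := EVT_min_rV O0 Oc Fcont.
have /getPex[] : exists y, argmin (Omega P) F y; last by [].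
by exists y; split => [|z Oz]; [rewrite inE in yO|apply: ymin; rewrite inE].
Qed.

Lemma cmin_complementary (s t : 'rV[R]_m) :
  nonneg s -> nonneg t -> (forall i, s 0 i * t 0 i = 0) -> cmin s t = 0.
Proof.
move=> s0 t0 st; apply/rowP => i; rewrite !mxE.
have /eqP := st i; rewrite mulf_eq0 => /orP[]/eqP => [si|ti].
  by rewrite si min_l.
by rewrite ti min_r.
Qed.

(** A minimizer x of L_q is a fixed point of the projected gradient map: pairing
    the KKT equation of the projection y with y - x gives
    |y - x|^2 + g.(y - x) - mu.r(x) = 0, where the last two terms are nonnegative
    by first-order optimality of x and by the signs of mu and r.  With y = x the
    KKT system of the projection problem is exactly the KKT system measured by
    E_{m,1} at the updated multipliers. *)
Lemma Em1_global_step (nu : 'rV[R]_l) (q : R) (x : 'rV[R]_n) (mu : 'rV[R]_m) :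
  compact (Omega P) ->
  differentiable (obj P) x -> differentiable (eqc P) x ->
  argmin (Omega P) (fun z => lagr_q P q z nu) x ->
  is_proj_mult P nu q x 1 mu ->
  Em1 P x (nu + (2%:R * q) *: eqc P x) mu = 0.
Proof.
move=> Oc fx hx [Ox xmin] [mu0 kkt compl].
set y := ypt P nu q x 1 in kkt compl.
have Oy : Omega P y by apply: ypt_feasible => //; exists x.
rewrite scale1r in kkt.
have foc : 0 <= dot (grad_q P nu q x) (y - x).
  rewrite grad_qE//; apply: (derive_ge0_at_min (is_derive_lagr_q _ _ _ fx hx)).
  near=> t; apply: xmin; apply: Omega_segment => //; apply/andP; split.
    by apply: ltW; near: t; exact: nbhs_right_gt.
  by near: t; apply: nbhs_right_le.
have muy : dot mu (resid P y) = 0 by apply: big1 => i _; exact: compl.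
have mux : dot mu (resid P x) <= 0.
  by apply: sumr_le0 => i _; rewrite mulr_ge0_le0// Ox.
have yx : y = x.
  apply/eqP; rewrite -subr_eq0; apply/eqP/sqnorm_eq0/eqP.
  rewrite eq_le sqnorm_ge0 andbT.
  have : dot (y - x + grad_q P nu q x + mu *m matA P) (y - x) = 0.
    by rewrite kkt dot0l.
  rewrite !dotDl -dotDl dot_mul_matA muy /sqnorm.
  lra.
rewrite yx subrr add0r grad_qE// in kkt.
rewrite /Em1 grad_lagrE// kkt {1}/sqnorm dot0l add0r.
rewrite cmin_complementary//; first by rewrite /sqnorm dot0l.
  by move=> i; rewrite mxE oppr_ge0.
by move=> i; rewrite mxE mulNr mulrC -yx compl oppr0.
Unshelve. all: by end_near. Qed.

(** Full row rank makes the linearized system Dh d = - h(x), A_act d = 0 solvable.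
    Its solution d is a feasible direction along which |h|^2 has slope
    - 2 |h(x)|^2, so a minimizer x cannot have h(x) <> 0. *)
Lemma Ec_stationary (x : 'rV[R]_n) :
  differentiable (eqc P) x -> argmin (Omega P) (Ec P) x ->
  row_free (col_mx (Dh P x) (active_rows P x)) -> eqc P x = 0.
Proof.
move=> hx [Ox xmin] free.
pose M := col_mx (Dh P x) (active_rows P x).
pose d : 'rV[R]_n := row_mx (- eqc P x) 0 *m (pinvmx M)^T.
have dM : d *m M^T = row_mx (- eqc P x) 0.
  by rewrite -mulmxA -trmx_mul mulmxVp// trmx1 mulmx1.
have [dDh dA] : d *m (Dh P x)^T = - eqc P x /\ d *m (active_rows P x)^T = 0.
  by move: dM; rewrite tr_col_mx mul_mx_row => /eq_row_mx.
have dact i : i \in active P x -> (d *m (matA P)^T) 0 i = 0.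
  move=> iact; have /rowP/(_ (enum_rank_in iact i)) := dA.
  rewrite !mxE => dAi; rewrite -[RHS]dAi; apply: eq_bigr => j _.
  by rewrite !mxE enum_rankK_in.
have : 0 <= 2%:R * dot (eqc P x) (d *m (Dh P x)^T).
  apply: (derive_ge0_at_min (is_derive_Ec d hx)).
  (* Active constraints stay active along d, and inactive ones stay satisfied
     for a short time. *)
  near=> t; apply: xmin => i; rewrite resid_line mxE [X in _ + X]mxE.
  move: i; near: t; apply: filter_forall => i.
  have [iact|inact] := boolP (i \in active P x).
    near=> t; rewrite dact// mulr0 addr0; exact: Ox.
  have ri : 0 < - resid P x 0 i.
    by rewrite oppr_gt0 lt_neqAle Ox andbT; move: inact; rewrite inE.
  near=> t.
  have t0 : 0 < t by near: t; exact: nbhs_right_gt.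
  set a := (d *m _) 0 i.
  (* 1 + |a| is a positive bound for the slope a, whatever its sign. *)
  have ta : t * (1 + `|a|) <= - resid P x 0 i.
    rewrite -ler_pdivlMr ?ltr_pwDl//; near: t; apply: nbhs_right_le.
    by rewrite divr_gt0// ltr_pwDl.
  have := ler_norm a; nra.
rewrite dDh dotC dotNl => Ec0; apply/sqnorm_eq0/eqP.
by rewrite eq_le sqnorm_ge0 andbT; rewrite /sqnorm; lra.
Unshelve. all: by end_near. Qed.

End first_order.

(** * The penalty method *)

Section penalty.
Variables (R : realType) (n m l : nat) (P : problem R n m l).
Hypothesis Oc : compact (Omega P).
Hypothesis f_diff : forall x, Omega P x -> differentiable (obj P) x.
Hypothesis h_diff : forall x, Omega P x -> differentiable (eqc P) x.

Lemma Ec_continuous (x : 'rV[R]_n) : Omega P x ->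
  Ec P z @[z --> x] --> Ec P x.
Proof.
by move=> /h_diff/differentiable_continuous hx; exact: (cvg_dot hx hx).
Qed.

(** The bound is uniform in x and explicit in nu: f and |h|^2 are bounded on the
    polyhedron, which is compact, and the multiplier term is controlled by
    |nu|^2 + |h|^2. *)
Lemma lagr_bounded : exists C : R, forall x nu, Omega P x ->
  `|obj P x + dot nu (eqc P x)| <= C + sqnorm nu.
Proof.
have [[x0 Ox0]|O0] := pselect (Omega P !=set0); last first.
  by exists 0 => x nu Ox; exfalso; apply: O0; exists x.
pose B x := `|obj P x| + Ec P x.
have Bcont : {within Omega P, continuous B}.
  apply: continuous_in_subspaceT => x /set_mem Ox.
  have fx : obj P z @[z --> x] --> obj P x.
    exact: (differentiable_continuous (f_diff Ox)).
  exact: (cvgD (cvg_norm fx) (Ec_continuous Ox)).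
have [y _ ymax] := EVT_max_rV (ex_intro _ x0 Ox0) Oc Bcont.
exists (B y) => x nu Ox; have := ymax x; rewrite inE => /(_ Ox).
have := ler_normD (obj P x) (dot nu (eqc P x)).
have := norm_dot_le nu (eqc P x).
have := sqnorm_ge0 nu; have := sqnorm_ge0 (eqc P x).
rewrite /B /Ec; lra.
Qed.

(** Comparing the values of L_q at its minimizer x and at z bounds the weighted
    excess of infeasibility by the variation of the unpenalized part, which does
    not depend on q. *)
Lemma Ec_penalty : exists C : R, forall q nu x z,
  argmin (Omega P) (fun y => lagr_q P q y nu) x -> Omega P z ->
  q * (Ec P x - Ec P z) <= C + 2%:R * sqnorm nu.
Proof.
have [C CP] := lagr_bounded; exists (2%:R * C) => q nu x z [Ox xmin] Oz.
have := xmin z Oz; rewrite /lagr_q -/(Ec P x) -/(Ec P z).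
have := CP x nu Ox; have := CP z nu Oz; rewrite !ler_norml.
move=> /andP[? ?] /andP[? ?]; lra.
Qed.

(** Dividing the estimate of [Ec_penalty] by q -> oo shows that the limit xs
    minimizes |h|^2 over the polyhedron; the rank condition at xs then forces the
    minimum to be 0. *)
Lemma penalty_limit_feasible (S : R) (q : nat -> R) (nu : nat -> 'rV[R]_l)
    (x : nat -> 'rV[R]_n) (xs : 'rV[R]_n) :
  (forall i, argmin (Omega P) (fun y => lagr_q P (q i) y (nu i)) (x i)) ->
  (forall i, sqnorm (nu i) <= S) ->
  (forall M, \forall i \near \oo, M <= q i) ->
  Omega P xs -> x i @[i --> \oo] --> xs ->
  row_free (col_mx (Dh P xs) (active_rows P xs)) ->
  Ec P (x i) @[i --> \oo] --> 0.
Proof.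
move=> xmin nuS qoo Oxs xxs free.
have Exs : Ec P (x i) @[i --> \oo] --> Ec P xs.
  exact: (cvg_comp _ _ xxs (Ec_continuous Oxs)).
suff -> : 0 = Ec P xs by [].
rewrite /Ec (Ec_stationary (h_diff Oxs) _ free) ?/sqnorm ?dot0l//.
split=> // z Oz; have [C CP] := Ec_penalty.
apply/ler_addgt0Pr => e e0.
apply: (ler_cvg_to Exs (cvg_cst (Ec P z + e : R))); near=> i.
have := CP _ _ _ z (xmin i) Oz; have := nuS i => Si.
have qM : Num.max 1 ((C + 2%:R * S) / e) <= q i by near: i; exact: qoo.
move: qM; rewrite ge_max => /andP[q1]; rewrite ler_pdivrMr// => qe qE.
have : q i * (Ec P (x i) - Ec P z) <= q i * e by lra.
rewrite ler_pM2l; lra.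
Unshelve. all: by end_near. Qed.

End penalty.

(** * The execution of the algorithm *)

Lemma contraction_frequently_small (R : realType) (theta : R) (u : nat -> R)
    (N0 : nat) :
  0 < theta < 1 -> (forall k, (N0 <= k)%N -> u k.+1 <= theta * u k) ->
  forall e N, 0 < e -> exists2 k, (N <= k)%N & u k <= e.
Proof.
move=> /andP[theta0 theta1] uS e N e0.
have uj j : u (N0 + j)%N <= theta ^+ j * u N0.
  elim: j => [|j IHj]; first by rewrite addn0 mul1r.
  rewrite addnS exprS -mulrA; apply: le_trans (uS _ (leq_addr _ _)) _.
  by rewrite ler_pM2l.
have theta_cvg : theta ^+ j * u N0 @[j --> \oo] --> 0 * u N0.
  have theta_norm : `|theta| < 1 by rewrite gtr0_norm.
  exact: (cvgM (cvg_expr theta_norm) (cvg_cst (u N0))).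
rewrite mul0r in theta_cvg.
have [J _ JP] := cvgr_le _ theta_cvg e e0.
exists (N0 + maxn J N)%N; first by rewrite (leq_trans (leq_maxr J N))// leq_addl.
by apply: le_trans (uj _) (JP _ _); rewrite /= leq_maxl.
Qed.

(** As q >= 1, each multiplication by phi adds at least phi - 1, so linear growth
    is enough for the conclusion. *)
Lemma geometric_growth (R : realType) (q : nat -> R) (S : nat -> Prop)
    (phi : R) :
  1 < phi -> 1 <= q 0%N -> (forall k, q k <= q k.+1) ->
  (forall k, S k -> phi * q k <= q k.+1) ->
  (forall N, exists2 k, (N <= k)%N & S k) ->
  forall M, \forall k \near \oo, M <= q k.
Proof.
move=> phi1 q0 qS qphi Sinf M.
have q_incr : nondecreasing_seq q by apply/nondecreasing_seqP.
have q1 k : 1 <= q k by apply: le_trans q0 _; exact: q_incr.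
have qj j : exists K, j%:R * (phi - 1) <= q K.
  elim: j => [|j [K IHj]]; first by exists 0%N; rewrite mul0r (le_trans ler01).
  have [k Kk Sk] := Sinf K; exists k.+1; apply: le_trans (qphi _ Sk).
  have := q_incr _ _ Kk; rewrite -natr1; have := q1 k; nra.
have [K qK] := qj (Num.bound `|M / (phi - 1)|).
exists K => // k /= Kk; apply: le_trans (q_incr _ _ Kk).
apply: le_trans qK; rewrite -ler_pdivrMr ?subr_gt0//.
by apply: le_trans (ler_norm _) _; apply: ltW; exact/archi_boundP.
Qed.

Section execution.
Variables (R : realType) (n m l : nat) (P : problem R n m l).
Variables (c : npasa_params R) (run : npasa_run R n m l).
Hypothesis Oc : compact (Omega P).
Hypothesis f_diff : forall x, Omega P x -> differentiable (obj P) x.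
Hypothesis h_diff : forall x, Omega P x -> differentiable (eqc P) x.
Hypothesis c_ok : npasa_params_ok c.
Hypothesis run_ok : is_npasa_run P c run.

Let theta_bounds : 0 < np_theta c < 1. Proof. by case: c_ok => -[]. Qed.

Lemma Em1_phase_one k : nr_gen run k = PhaseOne ->
  Em1 P (nr_x run k.+1) (nr_lam run k.+1) (nr_mu run k.+1) = 0.
Proof.
move=> gk; have [_ /(_ k)[_ _ + _]] := run_ok.
rewrite /npasa_advance gk => -[[_ xmin lamE muE] _].
rewrite /nr_lam lamE; have [Ox _] := xmin.
exact: (Em1_global_step Oc (f_diff Ox) (h_diff Ox) xmin muE).
Qed.

Lemma E1_phase_one k : nr_gen run k = PhaseOne ->
  E1 P (nr_it run k.+1) = Num.sqrt (Ec P (nr_x run k.+1)).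
Proof. by move=> gk; rewrite /E1 Em1_phase_one// add0r. Qed.

(** Since E_{m,1} vanishes after a global step, the test E_{m,1} <= theta E_c for
    leaving phase one succeeds at once: phase one never makes two steps in a
    row. *)
Lemma arr_phase_two k : nr_arr run k.+1 = PhaseTwo.
Proof.
have [_ /(_ k)[_ _ + _]] := run_ok; rewrite /npasa_advance.
case gk : (nr_gen run k) => // -[_ ->].
rewrite Em1_phase_one// mulr_ge0 ?sqnorm_ge0//.
by have /andP[/ltW] := theta_bounds.
Qed.

(** An iterate is generated in phase two only if the local step has passed the
    test of linear decrease. *)
Lemma E1_phase_two k : nr_gen run k = PhaseTwo ->
  E1 P (nr_it run k.+1) <= np_theta c * E1 P (nr_it run k).
Proof.
move=> gk; have [_ /(_ k)[_ + _ _]] := run_ok; rewrite /npasa_control.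
case: (nr_arr run k) => [[]|[t _]]; first by rewrite gk.
by case: ltP => [_ []|_ [_ _ ->//]]; rewrite gk.
Qed.

(** By [arr_phase_two], every global step after the first is preceded by a return
    from phase two, which multiplies the penalty by at least phi > 1. *)
Lemma penalty_unbounded : (forall N, exists2 k, (N <= k)%N &
    nr_gen run k = PhaseOne) ->
  forall M, \forall k \near \oo, M <= nr_q run k.
Proof.
have [[_ q0E _] steps] := run_ok.
have [[_ _ phi1 _ q01] _] := c_ok.
have phi0 : 0 <= np_phi c by rewrite ltW// (lt_trans ltr01).
have q_step k : 0 <= nr_q run k ->
    [/\ nr_q run k <= nr_q run k.+1 & nr_gen run k.+1 = PhaseOne ->
     np_phi c * nr_q run k <= nr_q run k.+1].
  move=> qk0; have [_ + _ _] := steps k.+1; rewrite /npasa_control arr_phase_two.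
  case=> t _; case: ifP => _ [-> ->//]; rewrite /=.
  have qphi : np_phi c * nr_q run k <=
      Num.max (np_phi c) (nr_e run k)^-1 * nr_q run k.
    by rewrite ler_wpM2r// le_max lexx.
  by split=> //; apply: le_trans qphi; rewrite ler_peMl// ltW.
have q1 k : 1 <= nr_q run k.
  elim: k => [|k IHk]; first by rewrite q0E.
  by have [+ _] := q_step k (le_trans ler01 IHk); exact: le_trans.
have q0 k : 0 <= nr_q run k := le_trans ler01 (q1 k).
move=> inf.
apply: (geometric_growth (S := fun k => nr_gen run k.+1 = PhaseOne) phi1) => //.
- by move=> k; have [] := q_step k (q0 k).
- by move=> k; have [_] := q_step k (q0 k); apply.
- by move=> N; have [[|k]// Nk gk] := inf N.+1; exists k.
Qed.

(** After a global step E_1 is the norm of h, so convergence of |h|^2 to 0 along a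
    convergent subsequence of global steps suffices.  The indices of the steps
    are k, and those of the points they compute k + 1. *)
Lemma E1_small_phase_one :
  (forall xs, subseq_limit (nr_x run) xs ->
      row_free (col_mx (Dh P xs) (active_rows P xs))) ->
  (forall N, exists2 k, (N <= k)%N & nr_gen run k = PhaseOne) ->
  forall e N, 0 < e -> exists2 k, (N <= k)%N & E1 P (nr_it run k) <= e.
Proof.
move=> full_rank inf e N e0; have [_ steps] := run_ok.
have [[_ _ _ lambar0 _] _] := c_ok.
have gs k : nr_gen run k = PhaseOne ->
    argmin (Omega P) (fun y => lagr_q P (nr_q run k) y
      (lam_proj c (nr_lam run k))) (nr_x run k.+1).
  by have [_ _ + _] := steps k; rewrite /npasa_advance => + gk; rewrite gk => -[[]].
have [phi [xs [phi_incr phiS Oxs xxs]]] := compact_subseq (S :=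
  [set k | nr_gen run k = PhaseOne]) Oc (fun k gk => (gs k gk).1) inf.
have phi_ge i : (i <= phi i)%N.
  by elim: i => // i IHi; apply: leq_ltn_trans IHi _; exact: phi_incr.
have free : row_free (col_mx (Dh P xs) (active_rows P xs)).
  by apply: full_rank; exists (fun i => (phi i).+1).
have q_phi M : \forall i \near \oo, M <= nr_q run (phi i).
  have [K _ KP] := penalty_unbounded inf M.
  by exists K => // i /= Ki; apply: KP; exact: leq_trans (phi_ge i).
have Ecvg := penalty_limit_feasible Oc f_diff h_diff
  (fun i => gs _ (phiS i)) (fun i => sqnorm_box_proj _ (ltW lambar0))
  q_phi Oxs xxs free.
have [K _ KP] := cvgr_le _ Ecvg (e ^+ 2) (exprn_gt0 2 e0).
exists (phi (maxn K N)).+1.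
  by rewrite (leq_trans (leq_maxr K N))// (leq_trans (phi_ge _)).
rewrite E1_phase_one//; last exact: phiS.
rewrite -[leRHS]ger0_norm ?(ltW e0)// -sqrtr_sqr; apply: ler_wsqrtr.
by apply: KP; rewrite /= leq_maxl.
Qed.

End execution.

Theorem theorem6p1 (R : realType) (n m l : nat) (P : problem R n m l)
    (c : npasa_params R) (run : npasa_run R n m l)
    (Omega_compact : compact (Omega P))
    (f_C1 : C1_on (V := R) (Omega P) (obj P))
    (h_C1 : C1_on (Omega P) (eqc P))
    (c_ok : npasa_params_ok c)
    (eps_eq0 : np_eps c = 0)
    (run_ok : is_npasa_run P c run)
    (x_feasible : forall k, Omega P (nr_x run k))
    (G1_G2 : forall k, generated_in run PhaseOne k ->
      let nu := lam_proj c (nr_lam run k.-1) in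
      let q := nr_q run k.-1 in
      condG1 P nu q (np_pasa c) (nr_x run k.-1) (nr_pasa run k.-1) /\
      condG2 P nu q (np_pasa c) (nr_x run k.-1) (nr_pasa run k.-1))
    (full_rank : forall xs, subseq_limit (nr_x run) xs ->
      row_free (col_mx (Dh P xs) (active_rows P xs))) :
  limn_einf (fun k => (E1 P (nr_it run k))%:E) = 0%E.
Proof.
apply: limn_einf_eq0 => [k|]; first exact: sqrtr_ge0.
have [f_diff _] := f_C1; have [h_diff _] := h_C1.
have [inf|fin] := pselect (forall N, exists2 k, (N <= k)%N &
    nr_gen run k = PhaseOne).
  exact: (E1_small_phase_one Omega_compact f_diff h_diff c_ok run_ok).
have /existsNP[N0 noN0] := fin.
have [[_ theta01 _ _ _] _] := c_ok.
apply: (contraction_frequently_small (N0 := N0) theta01) => k N0k.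
apply: (E1_phase_two run_ok); case gk : (nr_gen run k) => //.
by case: noN0; exists k.
Qed.
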